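(* Let $1<q<\infty$. The minimal constant $\bar{c}_1(q)>0$ for which $$\int_0^\infty\left(\frac{1}{t}\int_t^\infty f(s)^q\,\mathrm{d}s\right)^{\frac{1}{q}}\mathrm{d}t\leq\bar{c}_1(q)\int_0^\infty f(t)\,\mathrm{d}t$$ holds for all monotonically decreasing functions $f:(0,\infty)\to[0,\infty)$ is $$\bar{c}_1(q)=\frac{\pi}{q\sin\left(\frac{\pi}{q}\right)}.$$
   Context: Integrals of nonnegative functions take values in $[0,\infty]$. ''Monotonically decreasing'' means $f(s)\geq f(t)$ whenever $0<s\leq t$ (not necessarily strictly). *)

(* Defs.v *)
From mathcomp Require Import all_boot all_order all_algebra.
From mathcomp Require Import all_classical all_reals all_analysis.

Set Implicit Arguments.
Unset Strict Implicit.
Unset Printing Implicit Defensive.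

Import Order.TTheory GRing.Theory Num.Theory.
Import numFieldNormedType.Exports.

Local Open Scope classical_set_scope.
Local Open Scope ring_scope.

(* Functions on (0, +oo) are total functions R -> R constrained only at positive
   arguments; measurability on (0, +oo) follows from monotonicity. *)
Definition nonneg_decreasing {R : realType} (f : R -> R) : Prop :=
  (forall t, 0 < t -> 0 <= f t) /\
  (forall s t, 0 < s -> s <= t -> f t <= f s).

Definition averaged_tail_inequality {R : realType} (q c : R) (f : R -> R) : Prop :=
  let mu := @lebesgue_measure R in
  (\int[mu]_(t in `]0%R, +oo[)
     (((t^-1)%:E * \int[mu]_(s in `]t, +oo[) (f s `^ q)%:E) `^ (q^-1))
   <= c%:E * \int[mu]_(t in `]0%R, +oo[) (f t)%:E)%E.

Definition admissible_constants {R : realType} (q : R) : set R :=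
  [set c | 0 < c /\
    forall f : R -> R, nonneg_decreasing f -> averaged_tail_inequality q c f].

Definition is_minimum {R : realType} (A : set R) (m : R) : Prop :=
  A m /\ lbound A m.

(* Main.v *)
Require Import Defs.
From mathcomp Require Import all_boot all_order all_algebra.
From mathcomp Require Import all_classical all_reals all_analysis.
From mathcomp Require Import measurable_realfun ring lra.

Import Order.TTheory GRing.Theory Num.Theory.
Import numFieldNormedType.Exports.

Local Open Scope classical_set_scope.
Local Open Scope ring_scope.

(** Write c = pi / (q sin (pi / q)). For the indicator of (0, a) the
    inequality is an equality: its left-hand side is the Beta integral
      J(a) = int_0^a ((a - t) / t)^(1/q) dt = a c,
    and its right-hand side is c a. The case a = 1 shows that no constant
    below c is admissible ([constant_le_admissible]).

    Indicators are also the worst case. For fixed t the integrand on the left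
    is t^(-1/q) times the L^q norm of f on (t, oo), and a decreasing f is a
    superposition of indicators of initial segments A of (0, oo), namely its
    superlevel sets. Minkowski's inequality bounds the left-hand side by the
    superposition of the corresponding left-hand sides J(|A|) = c |A|, and the
    superposition of the lengths |A| is the integral of f. For finite
    superpositions this is [integral_tail_mean_downsets]; rounding f down to
    dyadic levels produces finite superpositions that increase to f, and
    monotone convergence, once inside and once outside, gives
    [averaged_tail_inequality_constant].

    The value of J is the reflection formula, obtained without Gamma
    functions. Cut (0, a) at a/2, where (a - t) / t = 1, and let A(b) be the
    integral of ((a - t) / t)^b over the upper half. The derivative of
    t ((a - t) / t)^b gives a recurrence between A(b) and A(b + 1), which says
    that P(b) = (A(b) / a + 1/2) / b satisfies P(b) + P(b + 1) = 1 / b; so P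
    behaves like Nielsen's beta function, the sum of (-1)^n / (b + n). The same
    derivative on the lower half, and the symmetry t -> a - t, yield
    J(a) = a b (P(b) + P(1 - b)) for b = 1/q.

    That P(x) + P(1 - x) = pi / sin (pi x) is proved in the manner of Herglotz
    ([nielsen_beta_reflection]). Both sides g satisfy
      3 g(x) = g(x/3) - g((x+1)/3) + g((x+2)/3),
    hence so does their difference D, and iteration writes 3^m D(x) as an
    alternating sum of 3^m values of D. Since D is a constant minus a decreasing
    bounded function of x and the same function of 1 - x, these alternating sums
    are bounded independently of m, so D = 0. *)

Local Notation mu := (@lebesgue_measure _).
Local Notation half_line R := (`]0, +oo[%classic : set R).

(** * Functions of Nielsen beta type and their triplication formula *)

(** Removing the first term leaves minus an alternating sum of the shifted
    sequence, which lies between 0 and d 1 <= d 0 by induction. *)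
Lemma alternating_sum_bounds {R : realType} (n : nat) (d : nat -> R) :
  (forall k, (k <= n)%N -> 0 <= d k) ->
  (forall k, (k < n)%N -> d k.+1 <= d k) ->
  0 <= \sum_(k < n.+1) (-1) ^+ k * d k <= d 0%N.
Proof.
elim: n d => [|n IHn] d d0 dd.
  by rewrite big_ord1 expr0 mul1r lexx andbT d0.
rewrite big_ord_recl/= expr0 mul1r.
have -> : \sum_(i < n.+1) (-1) ^+ bump 0 i * d (bump 0 i) =
    - \sum_(i < n.+1) (-1) ^+ i * d i.+1.
  rewrite -sumrN; apply: eq_bigr => i _.
  by rewrite /bump/= add1n exprS mulN1r mulNr.
have /andP[s0 s1] := IHn (fun k => d k.+1) (fun k kn => d0 k.+1 kn)
  (fun k kn => dd k.+1 kn).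
have := dd 0%N isT; lra.
Qed.

(** These properties characterize Nielsen's beta function, the sum of
    (-1)^n / (x + n): two functions with them differ by an antiperiodic function
    that vanishes at infinity. Taking them as an abstract interface keeps the
    reflection formula independent of the integral to which it is applied. *)
Definition nielsen_beta {R : realType} (P : R -> R) : Prop :=
  [/\ forall x, 0 < x -> 0 <= P x,
      forall x y, 0 < x -> x <= y -> P y <= P x,
      forall x, 0 < x -> P x <= x^-1 &
      forall x, 0 < x -> P x + P (x + 1) = x^-1].

(** [`|E|] is unchanged by x -> x + 1, while it tends to 0 at infinity. *)
Lemma antiperiodic_decay_eq0 {R : realType} (E : R -> R) (C : R) :
  (forall x, 0 < x -> E (x + 1) = - E x) ->
  (forall x, 0 < x -> `|E x| <= C / x) ->
  forall x, 0 < x -> E x = 0.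
Proof.
move=> Eanti Edecay x x0.
have En n : 0 < x + n%:R /\ `|E (x + n%:R)| = `|E x|.
  elim: n => [|n [xn0 IH]]; first by rewrite addr0.
  by rewrite -natr1 addrA Eanti// normrN IH; split=> //; lra.
have C0 : 0 <= C.
  by have := le_trans (normr_ge0 _) (Edecay _ x0); rewrite pmulr_lge0 ?invr_gt0.
apply/eqP; rewrite -normr_le0 leNgt; apply/negP => Ex0.
have [n] : exists n : nat, C / `|E x| < n%:R.
  by exists (Num.truncn (C / `|E x|)).+1; exact: truncnS_gt.
rewrite ltr_pdivrMr// => Cn.
have [xn0 xnE] := En n.
have := Edecay _ xn0; rewrite xnE ler_pdivlMr// leNgt => /negP; apply.
by nra.
Qed.

(** The right-hand side divided by 3 satisfies the same recurrence as P, because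
    its values at x and x + 1 telescope to P (x / 3) + P (x / 3 + 1) = 3 / x; so
    the difference of the two sides is antiperiodic and decays like 1 / x. *)
Lemma nielsen_beta_triplication {R : realType} (P : R -> R) :
  nielsen_beta P -> forall x, 0 < x ->
  3 * P x = P (x / 3) - P ((x + 1) / 3) + P ((x + 2) / 3).
Proof.
move=> [P0 _ Px Prec] x x0; apply/eqP; rewrite -subr_eq0; apply/eqP.
pose E y := 3 * P y - (P (y / 3) - P ((y + 1) / 3) + P ((y + 2) / 3)).
apply: (@antiperiodic_decay_eq0 R E 12) x0 => y y0; rewrite /E.
- have e0 := Prec _ y0; have y3 : 0 < y / 3 by lra.
  have e1 := Prec _ y3; rewrite invf_div in e1.
  have -> : (y + 1 + 1) / 3 = (y + 2) / 3 by field.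
  have -> : (y + 1 + 2) / 3 = y / 3 + 1 by field.
  by lra.
- have b z : y / 3 <= z -> 0 <= P z <= 3 / y.
    move=> yz; have z0 : 0 < z by apply: lt_le_trans yz; lra.
    rewrite P0//= (le_trans (Px _ z0))// -invf_div lef_pV2// posrE//; lra.
  have /andP[p1 q1] := b _ (lexx _).
  have /andP[p2 q2] := b ((y + 1) / 3) ltac:(lra).
  have /andP[p3 q3] := b ((y + 2) / 3) ltac:(lra).
  have p4 := P0 _ y0; have q4 := Px _ y0.
  have -> : 12 / y = 4 * (3 / y) by field; lra.
  rewrite ler_norml; apply/andP; split; lra.
Qed.

(** * Triplication of the cosecant, and the remainder of the cotangent *)

(** With c = cos (pi/3), the equation cos pi = -1 reads (c + 1)(2c - 1)^2 = 0. *)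
Lemma cos_pi_div3 {R : realType} : cos (pi / 3) = 2^-1 :> R.
Proof.
set t : R := pi / 3; have pi0 := pi_gt0 R.
have ct : 0 < cos t by apply: cos_gt0_pihalf; rewrite /t; apply/andP; split; lra.
have := cospi R; have -> : pi = t + t + t by rewrite /t; field.
rewrite !cosD sinD; have := cos2Dsin2 t; move: ct.
move: (cos t) (sin t) => c s c0 cs e.
have e1 : (c + 1) * (2 * c - 1) ^+ 2 = 0.
  have -> : (c + 1) * (2 * c - 1) ^+ 2 =
    ((c * c - s * s) * c - (s * c + c * s) * s + 1) + 3 * c * (c ^+ 2 + s ^+ 2 - 1).
    by ring.
  by rewrite e cs; ring.
move/eqP: e1; rewrite mulf_eq0 expf_eq0/= => /orP[/eqP|/eqP]; lra.
Qed.

(** With c, s the cosine and sine of y and u = sin (pi/3), the other two sines are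
    A = c u + s/2 and B = c u - s/2. Then sin (3y) = 4 s A B, and the numerator
    A B - s B + s A of the right-hand side equals 3/4 by Pythagoras. *)
Lemma cosecant_triplication {R : realType} (y : R) : 0 < y -> y < pi / 3 ->
  3 / sin (3 * y) = (sin y)^-1 - (sin (y + pi / 3))^-1 + (sin (y + 2 * (pi / 3)))^-1.
Proof.
move=> y0 y3; set t : R := pi / 3.
have s0 : sin y != 0 by rewrite gt_eqF// sin_gt0_pi//; apply/andP; split; lra.
have s1 : sin (y + t) != 0.
  by rewrite gt_eqF// sin_gt0_pi// /t; apply/andP; split; lra.
have s2 : sin (y + 2 * t) != 0.
  by rewrite gt_eqF// sin_gt0_pi// /t; apply/andP; split; lra.
have s3 : sin (3 * y) != 0 by rewrite gt_eqF// sin_gt0_pi//; apply/andP; split; lra.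
have e3 : 3 * y = y + y + y by ring.
have e2 : 2 * t = t + t by ring.
have ct : cos t = 2^-1 := cos_pi_div3.
have st : sin t ^+ 2 = 3 / 4 by rewrite sin2cos2 ct; field.
move: s0 s1 s2 s3; rewrite e3 e2 !(sinD, cosD) ct.
have := cos2Dsin2 y; move: (cos y) (sin y) (sin t) st => c s u uu cs s0.
pose A := c * u + s / 2; pose B := c * u - s / 2.
have -> : s * 2^-1 + c * u = A by rewrite /A; ring.
have -> : s * (2^-1 * 2^-1 - u * u) + c * (u * 2^-1 + 2^-1 * u) = B.
  by rewrite -[u * u]expr2 uu /B; field.
have -> : (s * c + c * s) * c + (c * c - s * s) * s = 4 * (s * A * B).
  have -> : s * A * B = s * (c ^+ 2 * u ^+ 2 - s ^+ 2 / 4) by rewrite /A /B; field.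
  by rewrite uu; field.
move=> A0 B0 _.
have e : A * B - s * B + s * A = 3 / 4.
  have -> : A * B - s * B + s * A = u ^+ 2 * c ^+ 2 + 3 / 4 * s ^+ 2.
    by rewrite /A /B; field.
  by rewrite uu -mulrDr cs mulr1.
have -> : s^-1 - A^-1 + B^-1 = (A * B - s * B + s * A) / (s * A * B).
  by field; rewrite s0 A0 B0.
by rewrite e; field; rewrite s0 A0 B0.
Qed.

Lemma sin_le_id {R : realType} (y : R) : 0 <= y -> sin y <= y.
Proof.
move=> y0.
have d (x : R) : is_derive x 1 (fun x : R => x - sin x) (1 - cos x).
  by apply: is_deriveB.
have := @ger0_derive1_le_cc R (fun x => x - sin x) 0 y _ _ _ 0 y.
rewrite sin0 subrr subr_ge0; apply => //.
- by move=> x _; rewrite derive1E derive_val subr_ge0 cos_le1.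
- by apply: derivable_within_continuous => x _; apply: (@ex_derive _ _ _ _ _ _ _ (d _)).
- by rewrite in_itv/= lexx.
- by rewrite in_itv/= y0 lexx.
Qed.

Lemma mul_cos_le_sin {R : realType} (y : R) : 0 <= y <= pi -> y * cos y <= sin y.
Proof.
move=> /andP[y0 yp].
have d (x : R) : is_derive x 1 (fun x : R => sin x - x * cos x) (x * sin x).
  apply: is_derive_eq; rewrite /GRing.scale/=; ring.
have := @ger0_derive1_le_cc R (fun x => sin x - x * cos x) 0 y _ _ _ 0 y.
rewrite sin0 mul0r subrr subr_ge0; apply => //.
- move=> x; rewrite in_itv/= => /andP[x0 xy]; rewrite derive1E derive_val.
  by rewrite mulr_ge0 ?(ltW x0)// sin_ge0_pi//; apply/andP; split; lra.
- by apply: derivable_within_continuous => x _; apply: (@ex_derive _ _ _ _ _ _ _ (d _)).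
- by rewrite in_itv/= lexx.
- by rewrite in_itv/= y0 lexx.
Qed.

(** The derivative is 1 / sin^2 - 1 / z^2, nonnegative because sin z <= z. *)
Lemma cot_remainder_nondecreasing {R : realType} (x y : R) :
  0 < x -> x <= y -> y < pi ->
  x^-1 - cos x / sin x <= y^-1 - cos y / sin y.
Proof.
move=> x0 xy yp.
have s0 (z : R) : z \in `]0, pi[ -> 0 < sin z.
  by rewrite in_itv/= => z0; apply: sin_gt0_pi.
have d (z : R) : z \in `]0, pi[ -> is_derive z 1
    (fun x : R => x^-1 - cos x / sin x) ((sin z) ^- 2 - z ^- 2).
  move=> z0; have sz := s0 _ z0.
  have z1 : 0 < z by move: z0; rewrite in_itv/= => /andP[].
  have di : is_derive z 1 (fun x : R => x^-1) (- z ^- 2 *: 1).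
    by apply: is_deriveV; rewrite gt_eqF.
  have ds : is_derive z 1 (fun x : R => (sin x)^-1) (- (sin z) ^- 2 *: cos z).
    by apply: is_deriveV; rewrite gt_eqF.
  apply: is_derive_eq; rewrite /GRing.scale/=.
  rewrite !mulr1 [LHS]addrC; congr (_ + _).
  rewrite -[RHS]mul1r -(cos2Dsin2 z).
  by field; rewrite gt_eqF.
apply: (@ger0_derive1_le_oo R (fun x => x^-1 - cos x / sin x) 0 pi) => //.
- by move=> z z0; apply: (@ex_derive _ _ _ _ _ _ _ (d _ z0)).
- move=> z z0; have dz := d z z0; rewrite derive1E derive_val subr_ge0.
  move: (z0); rewrite in_itv/= => /andP[z1 z2].
  rewrite lef_pV2 ?posrE ?exprn_gt0 ?s0//.
  by rewrite ler_pXn2r ?nnegrE ?(ltW z1) ?(ltW (s0 _ z0))// sin_le_id// ltW.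
- move=> z; rewrite inE/= => z0; apply/differentiable_continuous/derivable1_diffP.
  exact: (@ex_derive _ _ _ _ _ _ _ (d _ z0)).
- by rewrite in_itv/= x0 (le_lt_trans xy).
- by rewrite in_itv/= yp (lt_le_trans x0).
Qed.

(** What is left of (pi/2) cot (pi x / 2), up to sign, once its pole 1 / x is
    removed; it plays for the cosecant the part that P (x + 1) = 1 / x - P x plays
    for P. *)
Definition cot_remainder {R : realType} (x : R) : R :=
  x^-1 - pi / 2 * (cos (pi / 2 * x) / sin (pi / 2 * x)).

Lemma cot_remainder_bounds {R : realType} (x : R) : 0 < x -> x <= 1 ->
  0 <= cot_remainder x <= 1.
Proof.
move=> x0 x1; set h : R := pi / 2.
have h0 : 0 < h by rewrite /h divr_gt0 ?pi_gt0.
have hx0 : 0 < h * x by rewrite mulr_gt0.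
have hx1 : h * x <= h by rewrite ler_piMr ?(ltW h0).
have hp : h < pi by rewrite /h; have := pi_gt0 R; lra.
have xE : x^-1 = h * (h * x)^-1 by field; rewrite !gt_eqF.
rewrite /cot_remainder -/h xE -mulrBr; apply/andP; split.
  rewrite mulr_ge0 ?(ltW h0)// subr_ge0 ler_pdivrMr.
    rewrite ler_pdivlMl// mul_cos_le_sin// (ltW hx0) (le_trans hx1)//.
    exact: ltW.
  by rewrite sin_gt0_pi// hx0 (le_lt_trans hx1).
have := cot_remainder_nondecreasing _ _ hx0 hx1 hp.
rewrite /h cos_pihalf mul0r subr0 -/h => /(ler_wpM2l (ltW h0)).
by rewrite mulfV ?gt_eqF.
Qed.

Lemma cot_remainder_homo {R : realType} (x y : R) : 0 < x -> x <= y -> y <= 1 ->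
  cot_remainder x <= cot_remainder y.
Proof.
move=> x0 xy y1; set h : R := pi / 2; have y0 := lt_le_trans x0 xy.
have h0 : 0 < h by rewrite /h divr_gt0 ?pi_gt0.
have hp : h * y < pi.
  by rewrite /h; have := pi_gt0 R; nra.
have E (z : R) : 0 < z -> z^-1 = h * (h * z)^-1 by move=> z0; field; rewrite !gt_eqF.
rewrite /cot_remainder -/h (E x)// (E y)// -!mulrBr ler_pM2l//.
by apply: cot_remainder_nondecreasing => //; [rewrite mulr_gt0|rewrite ler_pM2l].
Qed.

(** This is the identity 2 / sin (2u) = cot u + tan u. *)
Lemma cosecant_cot_remainder {R : realType} (x : R) : 0 < x -> x < 1 ->
  pi / sin (pi * x) = x^-1 + (1 - x)^-1 - cot_remainder x - cot_remainder (1 - x).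
Proof.
move=> x0 x1; rewrite /cot_remainder.
have pi0 := pi_gt0 R.
have -> : pi / 2 * (1 - x) = - (pi / 2 * x - pi / 2) by ring.
rewrite cosN sinN cosBpihalf sinBpihalf opprK.
have -> : pi * x = pi / 2 * x + pi / 2 * x by field.
set u := pi / 2 * x.
have u0 : 0 < u by rewrite /u; nra.
have uh : u < pi / 2 by rewrite /u; nra.
have s0 : sin u != 0 by rewrite gt_eqF// sin_gt0_pihalf// u0.
have c0 : cos u != 0.
  by rewrite gt_eqF// cos_gt0_pihalf// uh andbT; lra.
rewrite sinD.
have -> : x^-1 + (1 - x)^-1 - (x^-1 - pi / 2 * (cos u / sin u)) -
  ((1 - x)^-1 - pi / 2 * (sin u / cos u)) =
  pi / 2 * ((cos u ^+ 2 + sin u ^+ 2) / (sin u * cos u)).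
  by field; rewrite s0 c0/=; apply/andP; split; rewrite gt_eqF//; lra.
have -> : sin u * cos u + cos u * sin u = 2 * (sin u * cos u) by ring.
by rewrite cos2Dsin2; field; rewrite s0 c0.
Qed.

(** * The reflection formula *)

(** Applying the hypothesis at the sample point (x + k) / N, N = 3^m, produces the
    sample points of indices k, N + k and 2N + k for 3N; as N is odd, the sign
    pattern + - + of the hypothesis agrees with the alternating signs. *)
Lemma triplication_iter {R : realType} (D : R -> R) :
  (forall x, 0 < x -> x < 1 ->
    3 * D x = D (x / 3) - D ((x + 1) / 3) + D ((x + 2) / 3)) ->
  forall m x, 0 < x -> x < 1 ->
  (3 ^ m)%:R * D x =
  \sum_(k < 3 ^ m) (-1) ^+ k * D ((x + k%:R) / (3 ^ m)%:R).
Proof.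
move=> D3; elim=> [|m IHm] x x0 x1.
  by rewrite expn0 big_ord1 mul1r addr0 divr1 expr0 mul1r.
rewrite expnS natrM -mulrA IHm//; set N := (3 ^ m)%N.
have N0 : 0 < N%:R :> R by rewrite ltr0n expn_gt0.
have sN : (-1) ^+ N = -1 :> R by rewrite -signr_odd /N oddX orbT expr1.
have D3k (k : 'I_N) : 3 * ((-1) ^+ k * D ((x + k%:R) / N%:R)) =
    (-1) ^+ k * D ((x + k%:R) / (3 * N)%:R) +
    (-1) ^+ (N + k) * D ((x + (N + k)%:R) / (3 * N)%:R) +
    (-1) ^+ (N + N + k) * D ((x + (N + N + k)%:R) / (3 * N)%:R).
  have kN : k%:R + 1 <= N%:R :> R by rewrite natr1 ler_nat.
  rewrite mulrCA D3; first last.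
  - by rewrite ltr_pdivrMr// mul1r; lra.
  - by rewrite divr_gt0// ltr_wpDr.
  rewrite !exprD sN mulrNN !mul1r mulN1r natrM (natrD _ (N + N)) !(natrD _ N).
  have -> : (x + k%:R) / (3 * N%:R) = (x + k%:R) / N%:R / 3.
    by field; rewrite gt_eqF.
  have -> : (x + (N%:R + k%:R)) / (3 * N%:R) = ((x + k%:R) / N%:R + 1) / 3.
    by field; rewrite gt_eqF.
  have -> : (x + (N%:R + N%:R + k%:R)) / (3 * N%:R) = ((x + k%:R) / N%:R + 2) / 3.
    by field; rewrite gt_eqF.
  by ring.
rewrite mulr_sumr (eq_bigr _ (fun k _ => D3k k)) !big_split/= -natrM.
move: ((3 * N)%:R : R) => M.
have -> : (3 * N = N + N + N)%N by rewrite mulSn mulSn mul1n addnA.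
by rewrite !big_split_ord.
Qed.

(** The difference D of the two sides inherits the triplication formula, and the
    poles cancel in it, leaving D x = 2 - dl x - dl (1 - x) with dl decreasing and
    bounded. An alternating sum of samples of dl is thus at most 2 whatever the
    number of samples, and [triplication_iter] gives `|D x| <= 2 / 3^m for all m. *)
Lemma nielsen_beta_reflection {R : realType} (P : R -> R) : nielsen_beta P ->
  forall x, 0 < x -> x < 1 -> P x + P (1 - x) = pi / sin (pi * x).
Proof.
move=> Pbeta; have [P0 Pmono Px Prec] := Pbeta.
pose D y := P y + P (1 - y) - pi / sin (pi * y).
pose dl y := P (y + 1) + (1 - cot_remainder y).
have DE y : 0 < y -> y < 1 -> D y = 2 - dl y - dl (1 - y).
  move=> y0 y1; rewrite /D /dl cosecant_cot_remainder//.
  have e1 := Prec _ y0; have e2 := Prec (1 - y) ltac:(lra); lra.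
have D3 y : 0 < y -> y < 1 -> 3 * D y = D (y / 3) - D ((y + 1) / 3) + D ((y + 2) / 3).
  move=> y0 y1; rewrite /D.
  have p1 := nielsen_beta_triplication _ Pbeta _ y0.
  have y1' : 0 < 1 - y by lra.
  have p2 := nielsen_beta_triplication _ Pbeta _ y1'.
  have -> : 1 - y / 3 = (1 - y + 2) / 3 by field.
  have -> : 1 - (y + 1) / 3 = (1 - y + 1) / 3 by field.
  have -> : 1 - (y + 2) / 3 = (1 - y) / 3 by field.
  have t0 : 0 < pi * y / 3 by rewrite !mulr_gt0 ?pi_gt0 ?invr_gt0.
  have t1 : pi * y / 3 < pi / 3 by rewrite ltr_pM2r ?invr_gt0// gtr_pMr ?pi_gt0.
  have := cosecant_triplication _ t0 t1.
  have -> : 3 * (pi * y / 3) = pi * y by field.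
  have -> : pi * y / 3 + pi / 3 = pi * ((y + 1) / 3) by field.
  have -> : pi * y / 3 + 2 * (pi / 3) = pi * ((y + 2) / 3) by field.
  rewrite -(mulrA pi) => p3.
  have -> : 3 * (P y + P (1 - y) - pi / sin (pi * y)) =
    3 * P y + 3 * P (1 - y) - pi * (3 / sin (pi * y)) by ring.
  by rewrite p1 p2 p3; ring.
have dl0 y : 0 < y -> y <= 1 -> 0 <= dl y <= 2.
  move=> y0 y1; have /andP[c0 c1] := cot_remainder_bounds _ y0 y1.
  have y10 : 0 < y + 1 by lra.
  have p0 := P0 _ y10.
  have p1 : P (y + 1) <= 1.
    by rewrite (le_trans (Px _ y10))// invf_le1//; lra.
  by rewrite /dl; apply/andP; split; lra.
have dlmono y z : 0 < y -> y <= z -> z <= 1 -> dl z <= dl y.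
  move=> y0 yz z1; have c := cot_remainder_homo _ _ y0 yz z1.
  have p : P (z + 1) <= P (y + 1) by apply: Pmono; lra.
  by rewrite /dl; lra.
have alt (N : nat) y : (0 < N)%N -> 0 < y -> y < 1 ->
    0 <= \sum_(k < N) (-1) ^+ k * dl ((y + k%:R) / N%:R) <= 2.
  case: N => // N _ y0 y1.
  have k0 (k : nat) : (k <= N)%N -> 0 < (y + k%:R) / N.+1%:R <= 1.
    move=> kN; rewrite divr_gt0 ?ltr0n//=; last by rewrite ltr_wpDr.
    rewrite ler_pdivrMr ?ltr0n// mul1r -natr1.
    by move: kN; rewrite -(ler_nat R); lra.
  have [||s0 s1] := andP (alternating_sum_bounds N
    (fun k => dl ((y + k%:R) / N.+1%:R)) _ _).
  - by move=> k /k0/andP[a b]; have /andP[] := dl0 _ a b.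
  - move=> k kN; have /andP[a _] := k0 k (ltnW kN); have /andP[_ b] := k0 k.+1 kN.
    apply: dlmono => //; rewrite ler_pM2r ?invr_gt0 ?ltr0n// -natr1; lra.
  rewrite s0 (le_trans s1)//; have /andP[a b] := k0 0%N isT.
  by have /andP[] := dl0 _ a b.
have altodd (N : nat) : odd N -> \sum_(k < N) (-1) ^+ k = 1 :> R.
  move=> oN; rewrite -[N]odd_double_half oN add1n.
  elim: N./2 => [|n IHn]; first by rewrite big_ord1.
  by rewrite doubleS !big_ord_recr/= in IHn *; rewrite IHn !exprS; ring.
have Dsmall m y : 0 < y -> y < 1 -> `|(3 ^ m)%:R * D y| <= 2.
  move=> y0 y1; rewrite (triplication_iter D D3)//; set N := (3 ^ m)%N.
  have N0 : (0 < N)%N by rewrite expn_gt0.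
  have oN : odd N by rewrite /N oddX orbT.
  have NR : 0 < N%:R :> R by rewrite ltr0n.
  have y1' : 0 < 1 - y by lra.
  have y1'' : 1 - y < 1 by lra.
  have -> : \sum_(k < N) (-1) ^+ k * D ((y + k%:R) / N%:R) =
     2 * (\sum_(k < N) (-1) ^+ k)
     - \sum_(k < N) (-1) ^+ k * dl ((y + k%:R) / N%:R)
     - \sum_(k < N) (-1) ^+ k * dl ((1 - y + k%:R) / N%:R).
    (* Reversing the order of the samples turns dl (1 - .) into samples of dl at
       1 - y, with unchanged signs because N is odd. *)
    rewrite [in X in _ = _ - X](reindex_inj rev_ord_inj)/= mulr_sumr -!sumrB.
    apply: eq_bigr => k _.
    have kN : k%:R + 1 <= N%:R :> R by rewrite natr1 ler_nat.
    rewrite DE; first last.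
    - by rewrite ltr_pdivrMr// mul1r; lra.
    - by rewrite divr_gt0// ltr_wpDr.
    rewrite natrB// -(natr1 k).
    have -> : (-1) ^+ (N - k.+1) = (-1) ^+ k :> R.
      rewrite -signr_odd -[RHS]signr_odd oddB// oN/=.
      by case: (odd k).
    have -> : (1 - y + (N%:R - (k%:R + 1))) / N%:R = 1 - (y + k%:R) / N%:R.
      by field; rewrite gt_eqF.
    by ring.
  rewrite altodd//.
  have /andP[a0 a1] := alt N y N0 y0 y1.
  have /andP[b0 b1] := alt N _ N0 y1' y1''.
  by rewrite ler_norml; apply/andP; split; lra.
move=> x x0 x1; apply/eqP; rewrite -subr_eq0 -normr_le0 -/(D x) leNgt.
apply/negP => Dx0.
have [n] : exists n : nat, 2 / `|D x| < n%:R.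
  by exists (Num.truncn (2 / `|D x|)).+1; exact: truncnS_gt.
rewrite ltr_pdivrMr// => nD.
have := Dsmall n _ x0 x1; rewrite normrM ger0_norm ?ler0n// leNgt => /negP; apply.
by rewrite (lt_le_trans nD)// ler_pM2r// ler_nat ltnW// ltn_expl.
Qed.

(** * Integrals of powers of the odds (a - t) / t *)

(** The power function has value 1 on negative numbers for every exponent, so the
    absolute value is needed for continuity at 0. *)
Lemma continuous_norm_powR {R : realType} (p x : R) : 0 < p \/ x != 0 ->
  {for x, continuous (fun x : R => `|x| `^ p)}.
Proof.
have [->|x0 _] := eqVneq x 0.
  case=> // p0; apply/cvgrPdist_lt => e e0; rewrite normr0 powR0 ?gt_eqF//.
  near=> y; rewrite sub0r normrN ger0_norm ?powR_ge0//.
  have -> : e = (e `^ p^-1) `^ p by rewrite -powRrM mulVf ?gt_eqF// powRr1 ?ltW.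
  rewrite gt0_ltr_powR ?nnegrE ?powR_ge0//.
  near: y; exists (e `^ p^-1); first by rewrite /= powR_gt0.
  by move=> y /=; rewrite sub0r normrN.
apply: (@continuous_comp _ _ _ (fun x : R => `|x|) (fun y : R => y `^ p)).
  exact: norm_continuous.
apply/differentiable_continuous/derivable1_diffP/derivable_powR.
by rewrite in_itv/= andbT normr_gt0.
Unshelve. all: by end_near. Qed.

(** The absolute value makes this function continuous on a neighbourhood of t = a
    when b > 0, which spares one-sided limits at that end point. *)
Definition odds_pow {R : realType} (a b t : R) : R := `|(a - t) / t| `^ b.

Lemma odds_powE {R : realType} (a b t : R) : 0 < t -> t <= a ->
  odds_pow a b t = ((a - t) / t) `^ b.
Proof. by move=> t0 ta; rewrite /odds_pow ger0_norm// divr_ge0 ?subr_ge0// ltW. Qed.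

Lemma odds_pow_continuous {R : realType} (a b t : R) :
  t != 0 -> 0 < b \/ t != a -> {for t, continuous (odds_pow a b)}.
Proof.
move=> t0 bta; apply: (@continuous_comp _ _ _ (fun t : R => (a - t) / t)
  (fun y : R => `|y| `^ b)).
  apply: continuousM; last exact: inv_continuous.
  by apply: continuousB => //; exact: cvg_cst.
apply: continuous_norm_powR; case: bta => [|ta]; [by left|right].
by rewrite mulf_neq0 ?invr_eq0// subr_eq0 eq_sym.
Qed.

(** With r = (a - t) / t one has r' = - a / t^2 and a / t = 1 + r, whence
    (t r^b)' = r^b - b r^(b-1) (1 + r). *)
Lemma is_derive_odds_pow {R : realType} (a b t : R) : 0 < t -> t < a ->
  is_derive t 1 (fun t => t * odds_pow a b t)
    ((1 - b) * odds_pow a b t - b * odds_pow a (b - 1) t).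
Proof.
move=> t0 ta; have tn0 : t != 0 by rewrite gt_eqF.
have r0 : 0 < (a - t) / t by rewrite divr_gt0// subr_gt0.
have dt : is_derive t 1 (fun x : R => x^-1) (- t ^- 2 *: 1) by apply: is_deriveV.
have dr : is_derive t 1 (fun t : R => (a - t) / t) (- a / t ^+ 2).
  by apply: is_derive_eq; rewrite /GRing.scale/=; field.
have dp : is_derive ((a - t) / t) 1 ((@powR R) ^~ b) (b * ((a - t) / t) `^ (b - 1)).
  exact: is_derive1_powR.
have dc := @is_derive1_comp R ((@powR R) ^~ b) (fun t => (a - t) / t) t _ _ dp dr.
have dg : is_derive t 1 (fun t => t * ((a - t) / t) `^ b)
    ((1 - b) * odds_pow a b t - b * odds_pow a (b - 1) t).
  have -> : (fun t => t * ((a - t) / t) `^ b) = id * ((@powR R) ^~ b \o (fun t => (a - t) / t)).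
    by apply/funext.
  apply: is_derive_eq; rewrite /GRing.scale/= !odds_powE ?(ltW ta)//.
  have -> : ((a - t) / t) `^ b = ((a - t) / t) * ((a - t) / t) `^ (b - 1).
    move: ((a - t) / t) r0 => r r0.
    by rewrite -[X in X * _]powRr1 ?(ltW r0)// -powRD ?(gt_eqF r0) ?implybT// addrC subrK.
  by field.
apply: near_eq_is_derive dg; near=> s.
rewrite odds_powE ?ltW//; near: s; [exact: lt_nbhsr | exact: lt_nbhsl].
Unshelve. all: by end_near. Qed.

Lemma odds_pow_within_continuous {R : realType} (a b u v : R) :
  0 < u -> v <= a -> 0 < b \/ v < a ->
  {within `[u, v], continuous (odds_pow a b)}.
Proof.
move=> u0 va bva; apply: continuous_in_subspaceT => t.
rewrite inE/= in_itv/= => /andP[ut tv].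
apply: odds_pow_continuous; first by rewrite gt_eqF// (lt_le_trans u0).
by case: bva => [|va']; [left|right; rewrite lt_eqF// (le_lt_trans tv)].
Qed.

Lemma odds_pow_integrable {R : realType} (a b u v : R) :
  0 < u -> v <= a -> 0 < b \/ v < a ->
  (@lebesgue_measure R).-integrable `[u, v] (EFin \o odds_pow a b).
Proof.
move=> u0 va bva; apply: continuous_compact_integrable; first exact: segment_compact.
exact: odds_pow_within_continuous.
Qed.

Lemma measurable_inv_gt0 {R : realType} (D : set R) : measurable D ->
  D `<=` `]0, +oo[ -> measurable_fun D (fun t : R => t^-1).
Proof.
move=> mD D0; apply: (measurable_funS _ D0); first exact: measurable_itv.
apply: open_continuous_measurable_fun; first exact: interval_open.
by move=> t; rewrite inE/= in_itv/= andbT => t0; apply: inv_continuous; rewrite gt_eqF.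
Qed.

Lemma measurable_odds_pow {R : realType} (D : set R) (a b : R) : measurable D ->
  D `<=` `]0, +oo[ -> measurable_fun D (odds_pow a b).
Proof.
move=> mD D0; apply: (@measurableT_comp _ _ _ _ _ _ ((@powR R) ^~ b)) => //.
apply: measurableT_comp => //; apply: measurable_funM; last exact: measurable_inv_gt0.
by apply: measurable_funB.
Qed.

Lemma integral_odds_pow_FTC {R : realType} (a b u v : R) :
  0 < u -> u < v -> v <= a -> 1 < b \/ v < a ->
  \int[mu]_(t in `[u, v])
    ((1 - b) * odds_pow a b t - b * odds_pow a (b - 1) t) =
  v * odds_pow a b v - u * odds_pow a b u.
Proof.
move=> u0 uv va bva.
have bva0 : 0 < b \/ v < a by case: bva => ?; [left; lra|right].
have bva1 : 0 < b - 1 \/ v < a by case: bva => ?; [left; lra|right].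
have cG : {within `[u, v], continuous (fun t => t * odds_pow a b t)}.
  move=> t; apply: continuousM; last exact: odds_pow_within_continuous.
  by apply: continuous_subspaceT => s; exact: cvg_id.
have cf : {within `[u, v],
    continuous (fun t => (1 - b) * odds_pow a b t - b * odds_pow a (b - 1) t)}.
  apply: continuous_in_subspaceT => t; rewrite inE/= in_itv/= => /andP[ut tv].
  have t0 : t != 0 by rewrite gt_eqF// (lt_le_trans u0).
  have ta : v < a -> t != a by move=> va'; rewrite lt_eqF// (le_lt_trans tv).
  apply: cvgB; (apply: cvgM; first exact: cvg_cst); apply: odds_pow_continuous => //.
    by case: bva0 => [|/ta]; [left|right].
  by case: bva1 => [|/ta]; [left|right].
rewrite /Rintegral (@continuous_FTC2 R _ (fun t => t * odds_pow a b t)) ?EFinB//.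
- have /(continuous_within_itvP _ uv)[_ cu cv] := cG.
  split=> // t; rewrite in_itv/= => /andP[ut tv].
  apply: (@ex_derive _ _ _ _ _ _ _ (is_derive_odds_pow a b t _ _)).
    exact: lt_trans ut.
  exact: lt_le_trans va.
- move=> t; rewrite in_itv/= => /andP[ut tv]; rewrite derive1E.
  apply: (@derive_val _ _ _ _ _ _ _ (is_derive_odds_pow a b t _ _)).
    exact: lt_trans ut.
  exact: lt_le_trans va.
Qed.

Definition half_odds_integral {R : realType} (a b : R) : R :=
  \int[mu]_(t in `[a / 2, a]) odds_pow a b t.

(** Integrate the derivative of t r^(b+1) over [a/2, a]: this function is a/2 at
    a/2, where r = 1, and 0 at a. *)
Lemma half_odds_integral_rec {R : realType} (a b : R) : 0 < a -> 0 < b ->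
  (b + 1) * half_odds_integral a b + b * half_odds_integral a (b + 1) = a / 2.
Proof.
move=> a0 b0.
have a20 : 0 < a / 2 by rewrite divr_gt0.
have ha : a / 2 < a by lra.
have := integral_odds_pow_FTC a (b + 1) (a / 2) a a20 ha (lexx _) ltac:(left; lra).
have io c : 0 < c -> (@lebesgue_measure R).-integrable `[a / 2, a] (EFin \o odds_pow a c).
  by move=> c0; apply: odds_pow_integrable => //; left.
have iZ k c : 0 < c ->
    (@lebesgue_measure R).-integrable `[a / 2, a] (EFin \o (fun t => k * odds_pow a c t)).
  move=> c0; rewrite (_ : _ \o _ = fun t => k%:E * (EFin \o odds_pow a c) t)%E.
    by apply: integrableZl => //; exact: io.
  by apply/funext => t; rewrite /= EFinM.
rewrite RintegralB ?RintegralZl//; try by [apply: iZ; lra|apply: io; lra].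
rewrite -!/(half_odds_integral _ _) addrK.
have -> : odds_pow a (b + 1) a = 0.
  by rewrite /odds_pow subrr mul0r normr0 powR0// gt_eqF//; lra.
have -> : odds_pow a (b + 1) (a / 2) = 1.
  rewrite /odds_pow (_ : (a - a / 2) / (a / 2) = 1) ?normr1 ?powR1//.
  by field; rewrite gt_eqF.
lra.
Qed.

Lemma half_odds_integral_bounds {R : realType} (a b : R) : 0 < a -> 0 < b ->
  0 <= half_odds_integral a b <= a / 2.
Proof.
move=> a0 b0; rewrite Rintegral_ge0/=; last by move=> t _; exact: powR_ge0.
have -> : a / 2 = \int[mu]_(t in `[a / 2, a]) 1.
  rewrite Rintegral_cst// /= lebesgue_measure_itv/= lte_fin ifT; last lra.
  by rewrite mul1r -EFinD/=; field.
apply: le_Rintegral => //; first by apply: odds_pow_integrable; [lra|lra|left].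
  apply: continuous_compact_integrable; first exact: segment_compact.
  by apply: continuous_subspaceT => t; exact: cvg_cst.
move=> t /=; rewrite in_itv/= => /andP[at2 ta].
have t0 : 0 < t by lra.
apply: (@le_trans _ _ (1 `^ b)); last by rewrite powR1.
rewrite odds_powE// ge0_ler_powR ?nnegrE ?(ltW b0)//.
  by rewrite divr_ge0 ?subr_ge0// ltW.
by rewrite ler_pdivrMr// mul1r; lra.
Qed.

Lemma half_odds_integral_antitone {R : realType} (a b c : R) : 0 < a -> 0 < b ->
  b <= c -> half_odds_integral a c <= half_odds_integral a b.
Proof.
move=> a0 b0 bc; have c0 := lt_le_trans b0 bc.
apply: le_Rintegral => //; first by apply: odds_pow_integrable; [lra|lra|left].
  by apply: odds_pow_integrable; [lra|lra|left].
move=> t /=; rewrite in_itv/= => /andP[at2 ta].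
have t0 : 0 < t by lra.
rewrite !odds_powE//; have [->|tna] := eqVneq t a.
  by rewrite subrr mul0r !powR0 ?gt_eqF.
have r0 : 0 < (a - t) / t by rewrite divr_gt0// subr_gt0 lt_neqAle tna.
apply: ger_powR => //; rewrite r0 ler_pdivrMr// mul1r; lra.
Qed.

(** The Beta integral is traditionally expressed with the integral of
    r^(b-1) / (1 + r) over [0, 1], a closed form of Nielsen's beta function; the
    present combination equals that integral after an integration by parts, but
    only involves a bounded integrand for every b > 0. *)
Definition half_odds_beta {R : realType} (a b : R) : R :=
  (half_odds_integral a b / a + 2^-1) / b.

Lemma half_odds_betaP {R : realType} (a : R) : 0 < a -> nielsen_beta (half_odds_beta a).
Proof.
move=> a0.
have bnd b : 0 < b -> 0 <= half_odds_integral a b / a <= 2^-1.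
  move=> b0; have /andP[A0 A1] := half_odds_integral_bounds _ _ a0 b0.
  by rewrite divr_ge0 ?(ltW a0)//= ler_pdivrMr// mulrC.
split=> [b b0|b c b0 bc|b b0|b b0]; rewrite /half_odds_beta.
- have /andP[A0 _] := bnd _ b0; rewrite divr_ge0 ?(ltW b0)//; lra.
- have c0 := lt_le_trans b0 bc; have /andP[A0 _] := bnd _ c0.
  apply: ler_pM; [lra|by rewrite invr_ge0 ltW| |by rewrite lef_pV2].
  by rewrite lerD2r ler_pM2r ?invr_gt0// half_odds_integral_antitone.
- have /andP[_ A1] := bnd _ b0; rewrite -[leRHS]mul1r ler_pM2r ?invr_gt0//; lra.
- have e := half_odds_integral_rec _ _ a0 b0.
  have b1 : b + 1 != 0 by rewrite gt_eqF//; lra.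
  have -> : half_odds_integral a (b + 1) = (a / 2 - (b + 1) * half_odds_integral a b) / b.
    by rewrite -e; field; rewrite gt_eqF.
  by field; rewrite b1 !gt_eqF.
Qed.

(** The exhaustion starts at a / 3 so that all its members are nondegenerate when
    c = a / 2. *)
Lemma bigcup_itvcc_lower {R : realType} (a c : R) : 0 < a ->
  \bigcup_n `[a / n.+3%:R, c]%classic = `]0, c]%classic.
Proof.
move=> a0; apply/seteqP; split=> [t [n _]|t]/=; rewrite !in_itv/=.
  by move=> /andP[at_ ->]; rewrite andbT (lt_le_trans _ at_)// divr_gt0.
move=> /andP[t0 tc]; exists (Num.truncn (a / t)) => //=; rewrite in_itv/= tc andbT.
rewrite ler_pdivrMr ?ltr0n// mulrC -ler_pdivrMr//.
by rewrite (le_trans (ltW (truncnS_gt _)))// ler_nat ltnS -addn2 leq_addr.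
Qed.

(** At t = a / n the function t r^b is of order n^(b-1). *)
Lemma odds_pow_vanish {R : realType} (a b : R) : 0 < a -> 0 < b -> b < 1 ->
  a / n.+3%:R * odds_pow a b (a / n.+3%:R) @[n --> \oo] --> 0.
Proof.
move=> a0 b0 b1.
have hc : `|harmonic n|%R `^ (1 - b) @[n --> \oo] --> (0 : R).
  have := @continuous_norm_powR R (1 - b) 0 ltac:(left; lra).
  rewrite /prop_for /continuous_at normr0 powR0 ?gt_eqF ?subr_gt0// => h.
  by apply: cvg_comp h; exact: cvg_harmonic.
have hc2 : a * `|harmonic n|%R `^ (1 - b) @[n --> \oo] --> a * 0.
  by apply: cvgM => //; exact: cvg_cst.
rewrite mulr0 in hc2.
apply: (squeeze_cvgr _ (cvg_cst 0) hc2); near=> n.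
have n0 : 0 < n.+3%:R :> R by [].
have u0 : 0 < a / n.+3%:R by rewrite divr_gt0.
rewrite mulr_ge0 ?(ltW u0) ?powR_ge0//= -mulrA ler_pM2l//.
rewrite odds_powE//; last by rewrite ler_pdivrMr// ler_pMr// ler1n.
rewrite ger0_norm ?harmonic_ge0//=.
have -> : (a - a / n.+3%:R) / (a / n.+3%:R) = n.+3%:R - 1.
  by field; rewrite !gt_eqF.
apply: (@le_trans _ _ (n.+3%:R `^ (b - 1))).
  rewrite powRB ?(gt_eqF n0) ?implybT// powRr1 ?(ltW n0)// mulrC ler_pM2r ?invr_gt0//.
  by rewrite ge0_ler_powR ?nnegrE ?(ltW b0) ?(ltW n0)// ?gerBl// subr_ge0 ler1n.
have -> : n.+1%:R^-1 `^ (1 - b) = (n.+1%:R `^ (1 - b))^-1.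
  by rewrite -powR_inv1 ?ler0n// -powRrM mulN1r powRN.
rewrite -opprB powRN.
rewrite lef_pV2 ?posrE ?powR_gt0//; apply: ge0_ler_powR; rewrite ?nnegrE ?ler0n//.
  by rewrite subr_ge0 ltW.
by rewrite ler_nat ltnS -addn2 leq_addr.
Unshelve. all: by end_near. Qed.

Lemma lower_odds_cvg {R : realType} (a b : R) : 0 < a ->
  (\int[mu]_(t in `[(a / n.+3%:R)%R, (a / 2)%R]) (odds_pow a b t)%:E @[n --> \oo] -->
  \int[mu]_(t in `]0%R, (a / 2)%R]) (odds_pow a b t)%:E)%E.
Proof.
move=> a0; rewrite -(bigcup_itvcc_lower a (a / 2) a0).
have n0 n : 0 < a / n.+3%:R by rewrite divr_gt0.
apply: ge0_nondecreasing_set_cvg_integral => //.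
- move=> m n mn; rewrite subsetEset; apply: subset_itvr; rewrite bnd_simp.
  by rewrite ler_pM2l// lef_pV2 ?posrE ?ltr0n// ler_nat !ltnS.
- move=> n; apply/measurable_EFinP; apply: measurable_odds_pow => // t/=.
  by rewrite !in_itv/= andbT => /andP[+ _]; apply: lt_le_trans.
- by move=> n t _; rewrite lee_fin powR_ge0.
Qed.

(** On the lower half r^b is unbounded, so the derivative of t r^b is integrated
    over [a / (n + 3), a/2] and n tends to infinity. *)
Lemma lower_odds_integral_rec {R : realType} (a b : R) : 0 < a -> 0 < b -> b < 1 ->
  ((1 - b)%:E * \int[mu]_(t in `]0%R, (a / 2)%R]) (odds_pow a b t)%:E =
  (a / 2)%:E + b%:E * \int[mu]_(t in `]0%R, (a / 2)%R]) (odds_pow a (b - 1) t)%:E)%E.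
Proof.
move=> a0 b0 b1.
have c1 := @cvgeZl _ _ _ _ _ (1 - b)%:E isT (lower_odds_cvg a b a0).
have c2 := @cvgeZl _ _ _ _ _ b%:E isT (lower_odds_cvg a (b - 1) a0).
have c3 : ((a / 2 - a / n.+3%:R * odds_pow a b (a / n.+3%:R))%:E
    @[n --> \oo] --> (a / 2)%:E)%E.
  apply: cvg_EFin; first exact: nearW.
  rewrite -[X in _ --> X]subr0; apply: cvgB; first exact: cvg_cst.
  exact: odds_pow_vanish.
have c4 := @cvgeD _ _ eventually_filter _ _ _ _ _ (@fin_num_adde_defr _ (a / 2)%:E _ isT) c3 c2.
rewrite -(cvg_lim _ c1)// -(cvg_lim _ c4)//; congr (lim (_ @ \oo)).
apply/funext => n.
have u0 : 0 < a / n.+3%:R by rewrite divr_gt0.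
have uv : a / n.+3%:R < a / 2 by rewrite ltr_pM2l// ltf_pV2 ?posrE ?ltr0n// ltr_nat.
have va : a / 2 < a by lra.
have io c : mu.-integrable `[a / n.+3%:R, a / 2] (EFin \o odds_pow a c).
  by apply: odds_pow_integrable => //; [exact: ltW|right].
have iZ k c : mu.-integrable `[a / n.+3%:R, a / 2] (EFin \o (fun t => k * odds_pow a c t)).
  rewrite (_ : _ \o _ = fun t => k%:E * (EFin \o odds_pow a c) t)%E.
    by apply: integrableZl => //; exact: io.
  by apply/funext => t; rewrite /= EFinM.
have fk c : (\int[mu]_(t in `[(a / n.+3%:R)%R, (a / 2)%R]) (odds_pow a c t)%:E =
    (\int[mu]_(t in `[a / n.+3%:R, a / 2]) odds_pow a c t)%:E)%E.
  by rewrite /Rintegral fineK//; exact: integrable_fin_num (io c).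
rewrite /= !fk -!EFinM -EFinD; congr (_%:E).
have := integral_odds_pow_FTC a b _ _ u0 uv (ltW va) (or_intror va).
rewrite RintegralB ?RintegralZl//.
have -> : odds_pow a b (a / 2) = 1.
  rewrite /odds_pow (_ : (a - a / 2) / (a / 2) = 1) ?normr1 ?powR1//.
  by field; rewrite gt_eqF.
by rewrite mulr1 => <-; rewrite subrK.
Qed.

(** The substitution t -> a - t exchanges the two halves and inverts r. *)
Lemma lower_odds_reflection {R : realType} (a b : R) : 0 < a -> 0 < b ->
  (\int[mu]_(t in `]0%R, (a / 2)%R]) (odds_pow a (- b) t)%:E =
   (half_odds_integral a b)%:E)%E.
Proof.
move=> a0 b0.
pose G t : R := `|t / (a - t)| `^ b.
have cG : {within `[0, a / 2], continuous G}.
  apply: continuous_in_subspaceT => t; rewrite inE/= in_itv/= => /andP[_ ta].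
  apply: (@continuous_comp _ _ _ (fun t : R => t / (a - t)) (fun y : R => `|y| `^ b)).
    apply: cvgM; first exact: cvg_id.
    apply: cvgV; first by rewrite gt_eqF// subr_gt0; lra.
    by apply: cvgB; [exact: cvg_cst|exact: cvg_id].
  by apply: continuous_norm_powR; left.
have mG : measurable_fun `]0, a / 2] G.
  apply: subspace_continuous_measurable_fun => //.
  by apply: continuous_subspaceW cG; exact: subset_itv_oc_cc.
transitivity (\int[mu]_(t in `]0%R, (a / 2)%R]) (G t)%:E)%E.
  apply: eq_integral => t _; congr (_%:E).
  rewrite /G /odds_pow -[t / (a - t)]invf_div normfV.
  by rewrite -[X in _ = X `^ _]powR_inv1// -powRrM mulN1r.
rewrite integral_itv_obnd_cbnd; last exact/measurable_EFinP.
pose F x : R := a - x.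
have dF : F^`()%classic = cst (-1).
  apply/funext => x; rewrite derive1E /F deriveB// derive_cst derive_id sub0r//.
have e0 : F a = 0 by rewrite /F subrr.
have e1 : F (a / 2) = a / 2 by rewrite /F; lra.
have ha : a / 2 <= a by lra.
have := @integration_by_substitution_decreasing R F G (a / 2) a ha.
rewrite e0 e1 => ->//.
- have io : mu.-integrable `[a / 2, a] (EFin \o odds_pow a b).
    by apply: odds_pow_integrable; [lra|exact: lexx|left].
  rewrite /half_odds_integral /Rintegral fineK; last exact: integrable_fin_num io.
  apply: eq_integral => t _; congr (_%:E).
  rewrite !fctE dF /cst opprK mulr1 /odds_pow /G /F.
  by rewrite (_ : a - (a - t) = t)//; ring.
- by move=> x y _ _ xy; rewrite /F ler_ltB.
- by rewrite dF => x _; exact: cvg_cst.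
- by rewrite dF; exact: is_cvg_cst.
- by rewrite dF; exact: is_cvg_cst.
- split=> [x _||].
  + exact: derivableB.
  + by apply: cvg_at_right_filter; apply: cvgB; [exact: cvg_cst|exact: cvg_id].
  + by apply: cvg_at_left_filter; apply: cvgB; [exact: cvg_cst|exact: cvg_id].
Qed.

(** With A the upper half integral, [lower_odds_integral_rec] and
    [lower_odds_reflection] express the lower half as (a/2 + b A(1-b)) / (1-b), and
    the sum of the halves is a b (P(b) + P(1-b)) for P = [half_odds_beta a]. *)
Lemma integral_odds_pow {R : realType} (a b : R) : 0 < a -> 0 < b -> b < 1 ->
  (\int[mu]_(t in `]0%R, a]) (odds_pow a b t)%:E =
   (a * (pi * b / sin (pi * b)))%:E)%E.
Proof.
move=> a0 b0 b1.
have a2 : a / 2 < a by lra.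
have a20 : 0 < a / 2 by lra.
have -> : `]0, a]%classic = `]0, a / 2] `|` `]a / 2, a] :> set R.
  by apply: itv_bndbnd_setU; rewrite bnd_simp ltW.
have mo (i : interval R) : [set` i] `<=` `]0, +oo[ ->
    measurable_fun [set` i] (EFin \o odds_pow a b).
  by move=> i0; apply/measurable_EFinP; exact: measurable_odds_pow.
have -> : pi * b / sin (pi * b) = b * (half_odds_beta a b + half_odds_beta a (1 - b)).
  by rewrite (nielsen_beta_reflection _ (half_odds_betaP _ a0))// mulrAC mulrC.
rewrite ge0_integral_setU//=; last 3 first.
- rewrite -itv_bndbnd_setU ?bnd_simp ?ltW//; apply: mo => t/=.
  by rewrite !in_itv/= andbT => /andP[].
- by move=> t _; rewrite lee_fin powR_ge0.
- apply/disj_setPS => t []/=; rewrite !in_itv/= => /andP[_ ?] /andP[? _]; lra.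
rewrite [X in (_ + X)%E]integral_itv_obnd_cbnd; last first.
  apply: mo => t/=; rewrite !in_itv/= andbT => /andP[? _]; lra.
have io : (@lebesgue_measure R).-integrable `[a / 2, a] (EFin \o odds_pow a b).
  by apply: odds_pow_integrable; [lra|exact: lexx|left].
have -> : (\int[mu]_(t in `[(a / 2)%R, a]) (odds_pow a b t)%:E =
    (half_odds_integral a b)%:E)%E.
  by rewrite /half_odds_integral /Rintegral fineK//; exact: integrable_fin_num io.
have := lower_odds_integral_rec a b a0 b0 b1.
have b10 : 0 < 1 - b by lra.
rewrite (_ : b - 1 = - (1 - b)); last by ring.
rewrite lower_odds_reflection//.
case: (X in (_ * X = _)%E -> _) => [l||].
- rewrite -EFinM -EFinD -EFinD => -[e]; congr (_%:E).
  have -> : l = (a / 2 + b * half_odds_integral a (1 - b)) / (1 - b).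
    by rewrite -e; field; rewrite gt_eqF.
  by rewrite /half_odds_beta; field; rewrite !gt_eqF.
- by rewrite mulry gtr0_sg// mul1e.
- by rewrite mulrNy gtr0_sg// mul1e.
Qed.

(** The preimages of the rays [x, +oo] are intervals. *)
Lemma measurable_decreasing_gt0 {R : realType} (f : R -> \bar R) :
  (forall s t, 0 < s -> s <= t -> (f t <= f s)%E) ->
  measurable_fun (`]0, +oo[%classic : set R) f.
Proof.
move=> fdec mD; apply: (measurability _ (ErealGenCInfty.measurableE R)) => //.
move=> _ [_ [x ->] <-]; apply: is_interval_measurable => s t /=.
rewrite !in_itv/= !andbT => -[s0 fs] [t0 ft] u /andP[su ut].
split; first by rewrite ?in_itv/= ?andbT (lt_le_trans s0).
by rewrite ?in_itv/= andbT (le_trans ft)// fdec// (lt_le_trans s0).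
Qed.

(** The clamped integrand is the left-hand integrand of the inequality for the
    indicator of an initial segment of length a. *)
Lemma integral_clamped_odds {R : realType} (a b : R) : 0 <= a -> 0 < b -> b < 1 ->
  (\int[mu]_(t in `]0%R, +oo[) ((Num.max (a - t) 0 / t) `^ b)%:E =
   (a * (pi * b / sin (pi * b)))%:E)%E.
Proof.
move=> a0 b0 b1.
have big0 t : 0 < t -> a < t -> (Num.max (a - t) 0 / t) `^ b = 0.
  move=> t0 at_; rewrite max_r ?subr_le0 ?(ltW at_)// mul0r powR0// gt_eqF//.
have [a0'|a0'] := leP a 0.
  have aE : a = 0 by apply/eqP; rewrite eq_le a0'.
  rewrite aE in big0 *; rewrite mul0r; apply: integral0_eq => t/=.
  by rewrite in_itv/= andbT => t0; rewrite big0.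
have -> : `]0, +oo[%classic = `]0, a] `|` `]a, +oo[ :> set R.
  by apply: itv_bndbnd_setU; rewrite bnd_simp ?ltW.
rewrite ge0_integral_setU//=; last 3 first.
- rewrite -itv_bndbnd_setU ?bnd_simp ?ltW//.
  apply/measurable_EFinP; apply: (@measurableT_comp _ _ _ _ _ _ ((@powR R) ^~ b)) => //.
  apply: measurable_funM; last exact: measurable_inv_gt0.
  by apply: measurable_maxr => //; apply: measurable_funB.
- by move=> t _; rewrite lee_fin powR_ge0.
- apply/disj_setPS => t []/=; rewrite !in_itv/= => /andP[_ ?]; rewrite andbT; lra.
rewrite -integral_odds_pow// [X in (_ + X)%E]integral0_eq ?adde0.
  apply: eq_integral => t; rewrite inE/= in_itv/= => /andP[t0 ta].
  by rewrite odds_powE// max_l// subr_ge0.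
by move=> t/=; rewrite in_itv/= andbT => at_; rewrite big0// (lt_trans a0').
Qed.

(** * Minkowski's inequality for superpositions of initial segments *)

(** If A meets (t, oo) then it contains (0, t], and measure t is lost. *)
Lemma downset_tail_measure {R : realType} (A : set R) (t : R) :
  A `<=` `]0, +oo[ -> (forall s u, 0 < s -> s <= u -> A u -> A s) ->
  (mu A < +oo)%E -> 0 < t ->
  (mu (A `&` `]t, +oo[) <= (Num.max (fine (mu A) - t) 0)%:E)%E.
Proof.
move=> A0 Adown Afin t0.
have mA : measurable A.
  apply: is_interval_measurable => s u As Au v /andP[sv vu].
  apply: (Adown _ u) => //; apply: lt_le_trans sv.
  by have := A0 _ As; rewrite /= in_itv/= andbT.
have [|/set0P[u [Au]]] := eqVneq (A `&` `]t, +oo[) set0.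
  by move=> ->; rewrite measure0 lee_fin le_max lexx orbT.
rewrite /= in_itv/= andbT => tu.
have AE : A = `]0, t]%classic `|` (A `&` `]t, +oo[).
  apply/seteqP; split=> [s As|s []]/=.
  - have := A0 _ As; rewrite /= in_itv/= andbT => s0; rewrite !in_itv/= s0 andbT/=.
    by case: (leP s t) => st; [left|right].
  - rewrite in_itv/= => /andP[s0 st]; apply: (Adown s u) => //.
    by rewrite (le_trans st)// ltW.
  - by case.
have mT : measurable (A `&` `]t, +oo[) by apply: measurableI.
have e : (mu A = t%:E + mu (A `&` `]t, +oo[))%E.
  rewrite [in LHS]AE measureU//.
    congr (_ + _)%E; have := @lebesgue_measure_itv R `]0, t].
    by rewrite /= lte_fin t0 sube0.
  apply/seteqP; split=> s//=; rewrite !in_itv/= andbT => -[/andP[_ st] [_ ts]].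
  by move: (le_lt_trans st ts); rewrite ltxx.
have : (mu (A `&` `]t, +oo[) \is a fin_num)%E.
  rewrite ge0_fin_numE//; apply: le_lt_trans Afin.
  by apply: le_measure; rewrite ?inE//; exact: subIset (or_introl _).
move: e; case: (mu (A `&` `]t, +oo[)) => // r -> _.
by rewrite -EFinD/= lee_fin (addrC t) addrK le_max lexx.
Qed.

Lemma Lnorm_sum_le {d} {T : measurableType d} {R : realType}
    (nu : {measure set T -> \bar R}) (q : R) (N : nat) (g : nat -> T -> R) :
  1 <= q -> (forall k, measurable_fun setT (g k)) ->
  (Lnorm nu q%:E (fun x => (\sum_(k < N) g k x)%:E) <=
   \sum_(k < N) Lnorm nu q%:E (EFin \o g k))%E.
Proof.
move=> q1 mg; elim: N => [|N IHN].
  rewrite big_ord0 (_ : (fun x => _) = cst 0%E) ?Lnorm0//.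
    by rewrite eqe gt_eqF// (lt_le_trans ltr01).
  by apply/funext => x; rewrite big_ord0.
rewrite big_ord_recr/= (_ : (fun x => _) =
  EFin \o ((fun x => \sum_(k < N) g k x) \+ g N)); last first.
  by apply/funext => x; rewrite big_ord_recr.
apply: (le_trans (minkowski_EFin _ _ _ _)) => //; first exact: measurable_sum.
by rewrite leeD2r.
Qed.

Lemma Lnorm_scaled_indic {d} {T : measurableType d} {R : realType}
    (nu : {measure set T -> \bar R}) (q h : R) (A : set T) :
  0 < q -> 0 <= h -> measurable A ->
  (Lnorm nu q%:E (fun x => (h * \1_A x)%:E) = h%:E * nu A `^ q^-1)%E.
Proof.
move=> q0 h0 mA; rewrite unlock.
rewrite (eq_integral (fun x => (h `^ q)%:E * (\1_A x)%:E)%E); last first.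
  move=> x _; rewrite /= ger0_norm ?mulr_ge0// powRM// EFinM.
  congr (_ * _%:E)%E; rewrite indicE; case: (_ \in _); first by rewrite powR1.
  by rewrite powR0// gt_eqF.
rewrite ge0_integralZl//; last 2 first.
  by apply/measurable_EFinP; exact: measurable_indic.
  by rewrite lee_fin powR_ge0.
rewrite integral_indic// setIT poweRM ?lee_fin ?powR_ge0// poweR_EFin -powRrM.
by rewrite mulfV ?gt_eqF// powRr1.
Qed.

(** Minkowski's inequality on D, transported to the whole line by replacing A k
    with its trace on D. *)
Lemma Lq_sum_indic_le {R : realType} (q h : R) (N : nat) (A : nat -> set R) (D : set R) :
  1 <= q -> 0 <= h -> (forall k, measurable (A k)) -> measurable D ->
  ((\int[mu]_(s in D) ((\sum_(k < N) h * \1_(A k) s) `^ q)%:E) `^ q^-1 <=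
   \sum_(k < N) h%:E * mu (A k `&` D) `^ q^-1)%E.
Proof.
move=> q1 h0 mA mD; have q0 : 0 < q by apply: lt_le_trans q1.
have := Lnorm_sum_le mu q N (fun k s => h * \1_(A k `&` D) s) q1.
have mAD k : measurable (A k `&` D) by apply: measurableI.
have ms k : measurable_fun setT (fun s => h * \1_(A k `&` D) s : R).
  by apply: measurable_funM => //; exact: measurable_indic.
move=> /(_ ms).
have LE (k : nat) := Lnorm_scaled_indic mu q h _ q0 h0 (mAD k).
rewrite (eq_bigr _ (fun (k : 'I_N) _ => LE k)).
rewrite unlock => le; apply: le_trans le; rewrite le_eqVlt; apply/orP; left; apply/eqP.
congr (_ `^ _)%E; rewrite [LHS]integral_mkcond; apply: eq_integral => s _.
rewrite patchE /= ger0_norm; last first.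
  by apply: sumr_ge0 => k _; rewrite mulr_ge0.
case: ifPn => sD.
  congr ((_ `^ _)%:E); apply: eq_bigr => k _; congr (_ * _).
  by rewrite !indicE in_setI sD andbT.
rewrite big1 ?powR0 ?gt_eqF// => k _.
by rewrite indicE in_setI (negbTE sD) andbF mulr0.
Qed.

(** * The averaged tail and its continuity from below *)

(** The integrand of the outer integral in [averaged_tail_inequality]. *)
Definition tail_mean {R : realType} (q : R) (f : R -> R) (t : R) : \bar R :=
  ((t^-1)%:E * \int[mu]_(s in `]t, +oo[) (f s `^ q)%:E)`^ q^-1.

Lemma measurable_tail_mean {R : realType} (q : R) (f : R -> R) :
  measurable_fun (half_line R) f -> measurable_fun (half_line R) (tail_mean q f).
Proof.
move=> mf; apply: (@measurableT_comp _ _ _ _ _ _ (fun x : \bar R => x `^ q^-1)%E).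
  exact: measurable_poweR.
apply: emeasurable_funM.
  by apply/measurable_EFinP; exact: measurable_inv_gt0.
apply: measurable_decreasing_gt0 => s t s0 st; apply: ge0_subset_integral => //.
- apply/measurable_EFinP; apply: (@measurableT_comp _ _ _ _ _ _ ((@powR R) ^~ q)) => //.
  apply: measurable_funS mf => // x/=; rewrite !in_itv/= !andbT; exact: lt_trans.
- by move=> x _; rewrite lee_fin powR_ge0.
- by move=> x/=; rewrite !in_itv/= !andbT; exact: le_lt_trans.
Qed.

Lemma tail_mean_ge0 {R : realType} (q : R) (f : R -> R) t : (0 <= tail_mean q f t)%E.
Proof. exact: poweR_ge0. Qed.

Lemma le_tail_mean {R : realType} (q : R) (f g : R -> R) t : 0 < q -> 0 < t ->
  measurable_fun (half_line R) f -> measurable_fun (half_line R) g ->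
  (forall s, 0 < s -> 0 <= f s <= g s) -> (tail_mean q f t <= tail_mean q g t)%E.
Proof.
move=> q0 t0 mf mg fg.
have tS : (`]t, +oo[%classic : set R) `<=` `]0, +oo[.
  by move=> x/=; rewrite !in_itv/= !andbT; exact: lt_trans.
have mq (k : R -> R) : measurable_fun (half_line R) k ->
    measurable_fun (`]t, +oo[%classic : set R) (fun s => (k s `^ q)%:E).
  move=> mk; apply/measurable_EFinP.
  apply: (@measurableT_comp _ _ _ _ _ _ ((@powR R) ^~ q)) => //.
  exact: measurable_funS mk.
have I0 (k : R -> R) : (0 <= \int[mu]_(s in `]t, +oo[) (k s `^ q)%:E)%E.
  by apply: integral_ge0 => s _; rewrite lee_fin powR_ge0.
have t1 : (0 <= (t^-1)%:E)%E by rewrite lee_fin invr_ge0 ltW.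
apply: gt0_ler_poweR; rewrite ?invr_ge0 ?(ltW q0)// ?in_itv/= ?leey ?mule_ge0//.
apply: lee_wpmul2l => //; apply: ge0_le_integral => //.
- by move=> s _; rewrite lee_fin powR_ge0.
- exact: mq.
- exact: mq.
- move=> s /tS/=; rewrite in_itv/= andbT => /fg/andP[f0 fgs].
  by rewrite lee_fin ge0_ler_powR ?nnegrE ?(ltW q0)// (le_trans f0).
Qed.

(** The map x -> x^r is an increasing bijection of [0, +oo] with inverse
    x -> x^(1/r), so it commutes with suprema; this covers the value +oo. *)
Lemma poweR_cvg_nondecreasing {R : realType} (u : nat -> \bar R) (l : \bar R) (r : R) :
  0 < r -> (forall n, 0 <= u n)%E -> {homo u : m n / (m <= n)%N >-> (m <= n)%E} ->
  u @ \oo --> l -> (u n `^ r)%E @[n --> \oo] --> (l `^ r)%E.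
Proof.
move=> r0 u0 und ul.
have lE : l = ereal_sup (range u).
  by rewrite -(cvg_lim _ ul)//; apply/cvg_lim => //; exact: ereal_nondecreasing_cvgn.
have ule n : (u n <= l)%E by rewrite lE; apply: ereal_sup_ubound; exists n.
have l0 : (0 <= l)%E := le_trans (u0 0%N) (ule 0%N).
have mono (p : R) (x y : \bar R) : 0 < p -> (0 <= x)%E -> (x <= y)%E ->
    (x `^ p <= y `^ p)%E.
  move=> p0 x0 xy; apply: gt0_ler_poweR; rewrite ?in_itv/= ?leey ?andbT ?(ltW p0)//.
  exact: le_trans xy.
have := @ereal_nondecreasing_cvgn R (fun n => u n `^ r)%E
  (fun m n mn => mono r _ _ r0 (u0 m) (und m n mn)).
set S := ereal_sup _; suff -> : S = (l `^ r)%E by [].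
apply/eqP; rewrite eq_le; apply/andP; split.
  by apply: ge_ereal_sup => _ [n _ <-]; exact: mono.
have Sn n : (u n `^ r <= S)%E by apply: ereal_sup_ubound; exists n.
have S0 : (0 <= S)%E := le_trans (poweR_ge0 _ _) (Sn 0%N).
have lS : (l <= S `^ r^-1)%E.
  rewrite lE; apply: ge_ereal_sup => _ [n _ <-].
  rewrite -[u n]poweRe1// -(@mulfV _ r) ?gt_eqF// poweRrM.
  by apply: mono => //; [rewrite invr_gt0|exact: poweR_ge0].
rewrite (le_trans (mono _ _ _ r0 l0 lS))// -poweRrM mulVf ?gt_eqF//.
by rewrite poweRe1.
Qed.

Lemma tail_mean_cvg {R : realType} (q : R) (u : nat -> R -> R) (f : R -> R) t :
  0 < q -> 0 < t -> (forall n, measurable_fun (half_line R) (u n)) ->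
  (forall n s, 0 < s -> 0 <= u n s) ->
  (forall s, 0 < s -> {homo u ^~ s : m n / (m <= n)%N >-> m <= n}) ->
  (forall s, 0 < s -> u n s @[n --> \oo] --> f s) ->
  tail_mean q (u n) t @[n --> \oo] --> tail_mean q f t.
Proof.
move=> q0 t0 mu_ u0 und uf.
have tS : (`]t, +oo[%classic : set R) `<=` `]0, +oo[.
  by move=> x/=; rewrite !in_itv/= !andbT; exact: lt_trans.
have mq n : measurable_fun (`]t, +oo[%classic : set R) (fun s => (u n s `^ q)%:E).
  apply/measurable_EFinP.
  apply: (@measurableT_comp _ _ _ _ _ _ ((@powR R) ^~ q)) => //.
  exact: measurable_funS (mu_ n).
have q0' n (s : R) : `]t, +oo[%classic s -> (0 <= (u n s `^ q)%:E)%E.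
  by move=> _; rewrite lee_fin powR_ge0.
have qnd (s : R) : `]t, +oo[%classic s ->
    {homo (fun n => (u n s `^ q)%:E) : m n / (m <= n)%N >-> (m <= n)%E}.
  move=> /tS/=; rewrite in_itv/= andbT => s0 m n mn.
  by rewrite lee_fin ge0_ler_powR ?nnegrE ?(ltW q0) ?u0 ?und.
have I0 n : (0 <= \int[mu]_(s in `]t, +oo[) (u n s `^ q)%:E)%E.
  by apply: integral_ge0 => s /q0'.
have Ind : {homo (fun n => \int[mu]_(s in `]t, +oo[) (u n s `^ q)%:E)%E :
    m n / (m <= n)%N >-> (m <= n)%E}.
  move=> m n mn; apply: ge0_le_integral => //.
  - by move=> s /q0'.
  - exact: mq.
  - exact: mq.
  - by move=> s /qnd; apply.
have cI : (\int[mu]_(s in `]t, +oo[) (u n s `^ q)%:E @[n --> \oo] -->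
    \int[mu]_(s in `]t, +oo[) (f s `^ q)%:E)%E.
  rewrite (_ : (\int[mu]_(s in `]t, +oo[) (f s `^ q)%:E)%E =
    (\int[mu]_(s in `]t, +oo[) limn (fun n => (u n s `^ q)%:E))%E).
    exact: cvg_monotone_convergence.
  apply: eq_integral => s; rewrite inE => /tS/=; rewrite in_itv/= andbT => s0.
  apply/esym/cvg_lim => //.
  apply: (@poweR_cvg_nondecreasing R (fun n => (u n s)%:E) (f s)%:E q q0).
  - by move=> n; rewrite lee_fin u0.
  - by move=> m n mn; rewrite lee_fin und.
  - by apply: cvg_EFin; [exact: nearW|exact: uf].
have t1 : (0 <= (t^-1)%:E)%E by rewrite lee_fin invr_ge0 ltW.
apply: poweR_cvg_nondecreasing; first by rewrite invr_gt0.
- by move=> n; rewrite mule_ge0.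
- by move=> m n mn; apply: lee_wpmul2l => //; exact: Ind.
- by apply: cvgeZl.
Qed.

(** Minkowski bounds the tail mean at t by the sum over k of
    h (max(|A k| - t, 0) / t)^(1/q), whose integral in t is known. *)
Lemma integral_tail_mean_downsets {R : realType} (q h : R) (N : nat)
    (A : nat -> set R) : 1 < q -> 0 <= h ->
  (forall k, A k `<=` `]0, +oo[) ->
  (forall k s u, 0 < s -> s <= u -> A k u -> A k s) ->
  (forall k, measurable (A k)) ->
  (forall k, (k < N)%N -> (mu (A k) < +oo)%E) ->
  (\int[mu]_(t in `]0%R, +oo[) tail_mean q (fun s => (\sum_(k < N) h * \1_(A k) s)%R) t <=
   (pi / (q * sin (pi / q)))%:E * \sum_(k < N) h%:E * mu (A k))%E.
Proof.
move=> q1 h0 A0 Adown mA Afin.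
have q0 : 0 < q by lra.
have qi0 : 0 < q^-1 by rewrite invr_gt0.
have qi1 : q^-1 < 1 by rewrite invf_lt1.
pose w k t : R := h * (Num.max (fine (mu (A k)) - t) 0 / t) `^ q^-1.
have mw k : measurable_fun (half_line R) (fun t => (w k t)%:E).
  apply/measurable_EFinP; apply: measurable_funM => //.
  apply: (@measurableT_comp _ _ _ _ _ _ ((@powR R) ^~ q^-1)) => //.
  apply: measurable_funM; last exact: measurable_inv_gt0.
  by apply: measurable_maxr => //; apply: measurable_funB.
have w0 k t : 0 <= w k t by rewrite mulr_ge0// powR_ge0.
have mg : measurable_fun (half_line R) (fun s => \sum_(k < N) h * \1_(A k) s : R).
  apply: measurable_sum => k; apply: measurable_funM => //; exact: measurable_indic.
apply: (@le_trans _ _ (\int[mu]_(t in `]0%R, +oo[) (\sum_(k < N) (w k t)%:E))%E).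
  apply: ge0_le_integral => //.
  - by move=> t _; exact: tail_mean_ge0.
  - exact: measurable_tail_mean.
  - by apply: emeasurable_sum => k; exact: mw.
  move=> t/=; rewrite in_itv/= andbT => t0.
  have t1 : (0 <= (t^-1)%:E)%E by rewrite lee_fin invr_ge0 ltW.
  rewrite /tail_mean poweRM//; last by apply: integral_ge0 => s _; rewrite lee_fin powR_ge0.
  apply: (@le_trans _ _ ((t^-1)%:E `^ q^-1 *
      \sum_(k < N) h%:E * mu (A k `&` `]t, +oo[) `^ q^-1)%E).
    by apply: lee_wpmul2l; [exact: poweR_ge0|apply: Lq_sum_indic_le => //; exact: ltW].
  rewrite ge0_sume_distrr; last by move=> k _; rewrite mule_ge0 ?lee_fin ?poweR_ge0.
  apply: lee_sum => k _; rewrite muleCA /w EFinM; apply: lee_wpmul2l; first by rewrite lee_fin.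
  rewrite -poweRM// -poweR_EFin.
  have tail := downset_tail_measure _ _ (A0 k) (Adown k) (Afin k (ltn_ord k)) t0.
  apply: gt0_ler_poweR; rewrite ?in_itv/= ?leey ?andbT ?(ltW qi0) ?mule_ge0//.
    by rewrite lee_fin divr_ge0 ?(ltW t0)// le_max lexx orbT.
  by rewrite mulrC EFinM; apply: lee_wpmul2l.
rewrite ge0_integral_sum//; last 2 first.
- by move=> k; exact: mw.
- by move=> k t _; rewrite lee_fin w0.
rewrite ge0_sume_distrr; last by move=> k _; rewrite mule_ge0 ?lee_fin.
apply: lee_sum => k _.
have Ak0 : 0 <= fine (mu (A k)) by rewrite fine_ge0.
have -> : mu (A k) = (fine (mu (A k)))%:E.
  by rewrite fineK// ge0_fin_numE// Afin.
under eq_integral do rewrite EFinM.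
rewrite ge0_integralZl_EFin//; last 2 first.
- by move=> t _; rewrite lee_fin powR_ge0.
- apply/measurable_EFinP; apply: (@measurableT_comp _ _ _ _ _ _ ((@powR R) ^~ q^-1)) => //.
  apply: measurable_funM; last exact: measurable_inv_gt0.
  by apply: measurable_maxr => //; apply: measurable_funB.
rewrite /= integral_clamped_odds// -!EFinM lee_fin le_eqVlt; apply/orP; left; apply/eqP.
by rewrite invfM; ring.
Qed.

(** * Rounding down to dyadic levels *)

Lemma count_levels {R : realType} (N : nat) (z : R) :
  \sum_(k < N) (k.+1%:R <= z)%R%:R = (minn N (Num.truncn z))%:R :> R.
Proof.
under eq_bigr do rewrite -truncn_gt_nat.
elim: N => [|N IHN]; first by rewrite big_ord0 min0n.
rewrite big_ord_recr/= IHN -natrD; congr (_%:R).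
case: (ltnP N (Num.truncn z)) => h.
  by rewrite (minn_idPl h) addn1.
by rewrite addn0 (minn_idPr (leqW h)).
Qed.

(** For y >= 0, this is y rounded down to a multiple of 2^-n and capped at n. Counting the
    levels that y reaches exhibits a function rounded in this way as a sum of
    indicators of superlevel sets. *)
Definition dyadic_floor {R : realType} (n : nat) (y : R) : R :=
  \sum_(k < n * 2 ^ n) (2 ^ n)%:R^-1 * (k.+1%:R * (2 ^ n)%:R^-1 <= y)%R%:R.

Lemma dyadic_floorE {R : realType} (n : nat) (y : R) :
  dyadic_floor n y = (2 ^ n)%:R^-1 * (minn (n * 2 ^ n) (Num.truncn (y * (2 ^ n)%:R)))%:R.
Proof.
have n0 : 0 < (2 ^ n)%:R :> R by rewrite ltr0n expn_gt0.
rewrite -count_levels mulr_sumr.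
by apply: eq_bigr => k _; rewrite ler_pdivrMr.
Qed.

Lemma dyadic_floor_ge0 {R : realType} (n : nat) (y : R) : 0 <= dyadic_floor n y.
Proof. by apply: sumr_ge0 => k _; rewrite mulr_ge0 ?invr_ge0. Qed.

Lemma dyadic_floor_le {R : realType} (n : nat) (y : R) : 0 <= y -> dyadic_floor n y <= y.
Proof.
move=> y0; have n0 : 0 < (2 ^ n)%:R :> R by rewrite ltr0n expn_gt0.
rewrite dyadic_floorE ler_pdivrMl// [leRHS]mulrC.
apply: (@le_trans _ _ (Num.truncn (y * (2 ^ n)%:R))%:R); first by rewrite ler_nat geq_minr.
by rewrite truncn_le mulr_ge0.
Qed.

(** The cap more than doubles in units of 2^-(n+1), and twice the integer part of z
    is at most the integer part of 2z. *)
Lemma dyadic_floor_homo {R : realType} (y : R) : 0 <= y ->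
  {homo (fun n => dyadic_floor n y) : m n / (m <= n)%N >-> m <= n}.
Proof.
move=> y0; apply/nondecreasing_seqP => n.
have n0 : 0 < (2 ^ n)%:R :> R by rewrite ltr0n expn_gt0.
rewrite !dyadic_floorE.
have -> : (2 ^ n.+1)%:R = 2 * (2 ^ n)%:R :> R by rewrite expnS natrM.
set m := minn _ _.
have -> : (2 ^ n)%:R^-1 * m%:R = (2 * (2 ^ n)%:R)^-1 * (2 * m)%:R :> R.
  by rewrite natrM; field; rewrite gt_eqF.
rewrite ler_pM2l ?invr_gt0 ?mulr_gt0// ler_nat leq_min; apply/andP; split.
  rewrite expnS mulnCA leq_mul2l/= (leq_trans (geq_minl _ _))// leq_mul2r leqnSn orbT//.
have z0 : 0 <= y * (2 ^ n)%:R by rewrite mulr_ge0.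
rewrite truncn_ge_nat; last by rewrite mulr_ge0// mulr_ge0.
rewrite natrM mulrCA ler_pM2l//.
apply: (@le_trans _ _ (Num.truncn (y * (2 ^ n)%:R))%:R); first by rewrite ler_nat geq_minr.
by rewrite truncn_le.
Qed.

Lemma dyadic_floor_cvg {R : realType} (y : R) : 0 <= y ->
  dyadic_floor n y @[n --> \oo] --> y.
Proof.
move=> y0.
have hc : y - (2 ^ n)%:R^-1 @[n --> \oo] --> y.
  rewrite -[X in _ --> X]subr0; apply: cvgB; first exact: cvg_cst.
  have := @cvg_geometric R 1 2^-1; rewrite ger0_norm// invf_lt1// ltr1n => /(_ isT).
  by apply: cvg_trans; apply: near_eq_cvg; near=> n; rewrite /geometric/= mul1r natrX exprVn.
apply: (squeeze_cvgr _ hc (cvg_cst y)); near=> n.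
rewrite dyadic_floor_le// andbT dyadic_floorE.
have n0 : 0 < (2 ^ n)%:R :> R by rewrite ltr0n expn_gt0.
have yn : y <= n%:R by near: n; exact: nbhs_infty_ger.
have z0 : 0 <= y * (2 ^ n)%:R by rewrite mulr_ge0.
rewrite (minn_idPr _).
  rewrite lerBlDr -[X in _ + X]mulr1 -mulrDr natr1 ler_pdivlMl// [leLHS]mulrC.
  exact/ltW/truncnS_gt.
rewrite -(ler_nat R) (le_trans (y := y * (2 ^ n)%:R)) ?truncn_le//.
by rewrite natrM ler_pM2r.
Unshelve. all: by end_near. Qed.

(** * The sharp inequality *)

Definition superlevel {R : realType} (f : R -> R) (c : R) : set R :=
  [set x | (0 < x) && (c <= f x)].

Lemma superlevel_gt0 {R : realType} (f : R -> R) c : superlevel f c `<=` `]0, +oo[.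
Proof. by move=> x /andP[x0 _]; rewrite /= in_itv/= x0. Qed.

Lemma superlevel_downset {R : realType} (f : R -> R) c s u :
  nonneg_decreasing f -> 0 < s -> s <= u -> superlevel f c u -> superlevel f c s.
Proof.
move=> [_ fd] s0 su /andP[u0 cu]; rewrite /superlevel/= s0/=.
by rewrite (le_trans cu)// fd.
Qed.

Lemma measurable_superlevel {R : realType} (f : R -> R) c :
  nonneg_decreasing f -> measurable (superlevel f c).
Proof.
move=> fnd; apply: is_interval_measurable => s u /andP[s0 _] cu v /andP[sv vu].
by apply: superlevel_downset cu => //; apply: lt_le_trans sv.
Qed.

Lemma nonneg_decreasing_measurable {R : realType} (f : R -> R) :
  nonneg_decreasing f -> measurable_fun (half_line R) f.
Proof.
move=> [f0 fd]; apply/measurable_EFinP; apply: measurable_decreasing_gt0.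
by move=> s t s0 st; rewrite lee_fin fd.
Qed.

(** If the integral of f is infinite there is nothing to prove. Otherwise the
    superlevel sets of f at positive levels have finite measure, so
    [integral_tail_mean_downsets] applies to the dyadic roundings u n of f, and
    both sides pass to the limit. *)
Lemma averaged_tail_inequality_constant {R : realType} (q : R) (f : R -> R) :
  1 < q -> nonneg_decreasing f ->
  averaged_tail_inequality q (pi / (q * sin (pi / q))) f.
Proof.
move=> q1 fnd; rewrite /averaged_tail_inequality/=.
have mf := nonneg_decreasing_measurable _ fnd.
have [f0 fd] := fnd.
have q0 : 0 < q by lra.
have C0 : 0 < pi / (q * sin (pi / q)).
  rewrite divr_gt0 ?pi_gt0// mulr_gt0// sin_gt0_pi// divr_gt0 ?pi_gt0//=.
  by rewrite ltr_pdivrMr// ltr_pMr// pi_gt0.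
have [->|fint] := eqVneq (\int[mu]_(t in `]0%R, +oo[) (f t)%:E)%E +oo%E.
  by rewrite mulry gtr0_sg// mul1e leey.
have {}fint : (\int[mu]_(t in `]0%R, +oo[) (f t)%:E < +oo)%E by rewrite ltey.
pose h n : R := (2 ^ n)%:R^-1.
have h0 n : 0 < h n by rewrite invr_gt0 ltr0n expn_gt0.
pose A n k : set R := superlevel f (k.+1%:R * h n).
pose u n s : R := \sum_(k < n * 2 ^ n) h n * \1_(A n k) s.
have uE n s : 0 < s -> u n s = dyadic_floor n (f s).
  move=> s0; apply: eq_bigr => k _; congr (_ * _).
  rewrite indicE /A /superlevel; congr (nat_of_bool _)%:R; apply/idP/idP.
    by rewrite inE/= s0.
  by move=> h1; rewrite inE/= s0.
have mA n k : measurable (A n k) by apply: measurable_superlevel.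
have mu_ n : measurable_fun (half_line R) (u n).
  by apply: measurable_sum => k; apply: measurable_funM => //; exact: measurable_indic.
have u0 n s : 0 < s -> 0 <= u n s by move=> s0; rewrite uE// dyadic_floor_ge0.
have und s : 0 < s -> {homo u ^~ s : m n / (m <= n)%N >-> m <= n}.
  by move=> s0 m n mn; rewrite !uE// dyadic_floor_homo// f0.
have uf s : 0 < s -> u n s @[n --> \oo] --> f s.
  by move=> s0; under eq_cvg do rewrite uE//; exact/dyadic_floor_cvg/f0.
have intu n : (\sum_(k < n * 2 ^ n) (h n)%:E * mu (A n k) =
    \int[mu]_(s in `]0%R, +oo[) (u n s)%:E)%E.
  under eq_integral do rewrite -sumEFin.
  rewrite ge0_integral_sum//; last 2 first.
  - move=> k; apply/measurable_EFinP; apply: measurable_funM => //. by apply: measurable_indic; exact: mA.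
  - by move=> k s _; rewrite lee_fin mulr_ge0// ltW.
  apply: eq_bigr => k _; under eq_integral do rewrite EFinM.
  rewrite ge0_integralZl_EFin ?(ltW (h0 n))//; last first.
    by apply/measurable_EFinP; apply: measurable_indic; exact: mA.
  by rewrite integral_indic ?setIidl//; [exact: superlevel_gt0|exact: mA].
have intuf n : (\int[mu]_(s in `]0%R, +oo[) (u n s)%:E <=
    \int[mu]_(s in `]0%R, +oo[) (f s)%:E)%E.
  apply: ge0_le_integral => //.
  - by move=> s/=; rewrite in_itv/= andbT lee_fin => /u0.
  - by apply/measurable_EFinP; exact: (mu_ n).
  - exact/measurable_EFinP.
  - move=> s/=; rewrite in_itv/= andbT lee_fin => s0.
    by rewrite uE// dyadic_floor_le// f0.
have Afin n k : (k < n * 2 ^ n)%N -> (mu (A n k) < +oo)%E.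
  move=> kn; have : ((h n)%:E * mu (A n k) < +oo)%E.
    apply: le_lt_trans (le_lt_trans (intuf n) fint); rewrite -intu.
    rewrite (bigD1 (Ordinal kn))//= leeDl// sume_ge0// => i _.
    by rewrite mule_ge0// lee_fin ltW.
  case: (mu (A n k)) => [r||]; rewrite ?ltry ?ltNyr//.
  by rewrite mulry gtr0_sg// mul1e ltxx.
have -> : (\int[mu]_(t in `]0%R, +oo[)
     ((t^-1)%:E * \int[mu]_(s in `]t, +oo[) (f s `^ q)%:E) `^ q^-1 =
   \int[mu]_(t in `]0%R, +oo[) limn (fun n => tail_mean q (u n) t))%E.
  apply: eq_integral => t; rewrite inE/= in_itv/= andbT => t0.
  by apply/esym/cvg_lim => //; exact: tail_mean_cvg.
have tnd t : `]0, +oo[%classic t ->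
    {homo (fun n => tail_mean q (u n) t) : m n / (m <= n)%N >-> (m <= n)%E}.
  rewrite /= in_itv/= andbT => t0 m n mn; apply: le_tail_mean => // s s0.
  by rewrite u0// und.
have mt n : measurable_fun (half_line R) (tail_mean q (u n)).
  exact: measurable_tail_mean.
rewrite monotone_convergence//; last by move=> n t _; exact: tail_mean_ge0.
apply: lime_le.
  apply: ereal_nondecreasing_is_cvgn => m n mn; apply: ge0_le_integral => //.
  - by move=> t _; exact: tail_mean_ge0.
  - exact: mt.
  - exact: mt.
  - by move=> t /tnd; apply.
near=> n; apply: (@le_trans _ _ ((pi / (q * sin (pi / q)))%:E *
    \sum_(k < n * 2 ^ n) (h n)%:E * mu (A n k))%E).
  apply: integral_tail_mean_downsets => //.
  - exact: ltW.
  - by move=> k; exact: superlevel_gt0.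
  - by move=> k s v s0 sv; apply: superlevel_downset.
  - by move=> k; exact: Afin.
by rewrite intu; apply: lee_wpmul2l => //; rewrite lee_fin ltW.
Unshelve. all: by end_near. Qed.

(** The inequality for the indicator of (0, 1] reads c0 <= c, where c0 is the
    stated constant. *)
Lemma constant_le_admissible {R : realType} (q c : R) : 1 < q ->
  (forall f : R -> R, nonneg_decreasing f -> averaged_tail_inequality q c f) ->
  pi / (q * sin (pi / q)) <= c.
Proof.
move=> q1 /(_ (fun t => (t <= 1)%R%:R)) H.
have q0 : 0 < q by lra.
have qi0 : 0 < q^-1 by rewrite invr_gt0.
have qi1 : q^-1 < 1 by rewrite invf_lt1.
have fnd : nonneg_decreasing (fun t : R => (t <= 1)%R%:R : R).
  split=> // s t s0 st; rewrite ler_nat.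
  by case: (leP t 1) => //= t1; rewrite (le_trans st t1).
move: H => /(_ fnd); rewrite /averaged_tail_inequality/=.
have fE (t : R) : (t <= 1)%R%:R = \1_(`]-oo, 1]%classic : set R) t :> R.
  by rewrite indicE mem_setE in_itv.
have tail (t : R) : 0 < t -> (\int[mu]_(s in `]t, +oo[) ((s <= 1)%R%:R `^ q)%:E =
    (Num.max (1 - t) 0)%:E)%E.
  move=> t0.
  transitivity (\int[mu]_(s in `]t, +oo[) (\1_(`]-oo, 1]%classic : set R) s)%:E)%E.
    apply: eq_integral => s _; rewrite -fE; congr (_%:E).
    by case: (leP s 1) => _; rewrite ?powR1// powR0// gt_eqF.
  rewrite integral_indic//.
  have -> : (`]-oo, 1]%classic : set R) `&` `]t, +oo[ = `]t, 1]%classic.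
    apply/seteqP; split=> s/=; rewrite !in_itv/= andbT; first by move=> [-> ->].
    by move=> /andP[].
  have := @lebesgue_measure_itv R `]t, 1]; rewrite /= lte_fin => ->.
  case: ltP => t1; first by rewrite max_l ?subr_ge0 ?(ltW t1)// EFinB.
  by rewrite max_r// subr_le0.
have -> : (\int[mu]_(t in `]0%R, +oo[) ((t <= 1)%R%:R : R)%:E = 1)%E.
  transitivity (\int[mu]_(s in `]0%R, +oo[) (\1_(`]-oo, 1]%classic : set R) s)%:E)%E.
    by apply: eq_integral => s _; rewrite -fE.
  rewrite integral_indic//.
  have -> : (`]-oo, 1]%classic : set R) `&` `]0, +oo[ = `]0, 1]%classic.
    apply/seteqP; split=> s/=; rewrite !in_itv/= andbT; first by move=> [-> ->].
    by move=> /andP[].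
  have := @lebesgue_measure_itv R `]0, 1]; rewrite /= lte_fin ltr01 => ->.
  by rewrite sube0.
rewrite mule1.
have -> : (\int[mu]_(t in `]0%R, +oo[)
     ((t^-1)%:E * \int[mu]_(s in `]t, +oo[) ((s <= 1)%R%:R `^ q)%:E) `^ q^-1 =
   \int[mu]_(t in `]0%R, +oo[) ((Num.max (1 - t) 0 / t) `^ q^-1)%:E)%E.
  apply: eq_integral => t; rewrite inE/= in_itv/= andbT => t0.
  by rewrite tail// -EFinM poweR_EFin mulrC.
rewrite integral_clamped_odds// mul1r lee_fin.
by rewrite invfM mulrA.
Qed.

Theorem theorem4p1 (R : realType) (q : R) (hq : 1 < q) :
  is_minimum (admissible_constants q) (pi / (q * sin (pi / q))).
Proof.
split; last by move=> c [_ H]; exact: constant_le_admissible.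
split; last by move=> f; exact: averaged_tail_inequality_constant.
rewrite divr_gt0 ?pi_gt0// mulr_gt0//; first by lra.
rewrite sin_gt0_pi// divr_gt0 ?pi_gt0//=; last by lra.
by rewrite ltr_pdivrMr ?ltr_pMr ?pi_gt0//; lra.
Qed.
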